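(* Let $n\ge 3$ and let $\alpha:I\to E^n$ be a smooth unit speed curve with Frenet frame $\{V_1,\dots,V_n\}$, whose curvatures $k_1,\dots,k_{n-1}$ vanish nowhere on $I$, and let $H_1,\dots,H_{n-2}$ be the harmonic curvature functions of $\alpha$. Then $\alpha$ is an inclined curve if and only if the function $\sum_{i=1}^{n-2}H_i^2$ is constant on $I$ and $H_{n-2}$ is not identically zero on $I$.
   Context: $E^n$ is $\mathbb{R}^n$ with the standard inner product $\langle\cdot,\cdot\rangle$, $I\subset\mathbb{R}$ is an open interval, and $s\in I$ is the arc-length parameter; a prime denotes $d/ds$. Frenet frame: $V_1=\alpha'$, $\{V_1,\dots,V_n\}$ is a smooth orthonormal frame along $\alpha$, and the curvature functions $k_1,\dots,k_{n-1}:I\to\mathbb{R}$ satisfy the Frenet formulas $V_1'=k_1V_2$, $V_i'=-k_{i-1}V_{i-1}+k_iV_{i+1}$ for $2\le i\le n-1$, and $V_n'=-k_{n-1}V_{n-1}$. Inclined curve: $\alpha$ is called an inclined curve (general helix, $V_1$-slant helix) if there exist a constant unit vector $X\in E^n$ and a constant angle $\varphi\neq\frac{\pi}{2}$ such that $\langle V_1(s),X\rangle=\cos\varphi$ for all $s\in I$. Harmonic curvatures: $H_i:I\to\mathbb{R}$, $0\le i\le n-2$, are defined by $H_0=0$, $H_1=\frac{k_1}{k_2}$, and $H_i=\frac{1}{k_{i+1}}\left(H_{i-1}'+k_iH_{i-2}\right)$ for $2\le i\le n-2$. *)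

(* Defs.v *)
From HB Require Import structures.
From mathcomp Require Import all_boot all_order all_algebra.
From mathcomp Require Import all_classical all_reals all_analysis.
Set Implicit Arguments.
Unset Strict Implicit.
Unset Printing Implicit Defensive.
Import Order.TTheory GRing.Theory Num.Theory.
Import numFieldNormedType.Exports.
Local Open Scope classical_set_scope.
Local Open Scope ring_scope.

(* Functions on the open interval I are represented by total functions on R;
   only their values on I matter. Since I is open, the derivatives at the points
   of I do not depend on the values taken outside I. *)

Definition open_interval (R : realType) (I : set R) : Prop :=
  [/\ I !=set0, open I & is_interval I].

(* C^infinity on I. *)
Definition smooth_on (R : realType) (V : normedModType R) (I : set R)
    (f : R -> V) : Prop :=
  forall (m : nat) (s : R), I s -> derivable (derive1n m f) s 1.

Definition dotp (R : realType) (n : nat) (u v : 'rV[R]_n) : R :=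
  \sum_(i < n) u 0 i * v 0 i.

(* The norm `|u| of the library on 'rV[R]_n is the sup norm, hence this one. *)
Definition enorm (R : realType) (n : nat) (u : 'rV[R]_n) : R :=
  Num.sqrt (dotp u u).

Definition unit_speed (R : realType) (n : nat) (I : set R)
    (alpha : R -> 'rV[R]_n) : Prop :=
  forall s, I s -> enorm (derive1 alpha s) = 1.

(* The frame V_1, ..., V_n and the curvatures k_1, ..., k_{n-1} are indexed by
   nat, starting from 1; the values at the other indices are irrelevant. *)
Record frenet_frame (R : realType) (n : nat) (I : set R)
    (alpha : R -> 'rV[R]_n) (V : nat -> R -> 'rV[R]_n)
    (k : nat -> R -> R) : Prop := FrenetFrame {
  frenet_tangent : forall s, I s -> V 1%N s = derive1 alpha s ;
  frenet_smooth : forall i, (1 <= i <= n)%N -> smooth_on I (V i) ;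
  frenet_orthonormal : forall i j s,
    (1 <= i <= n)%N -> (1 <= j <= n)%N -> I s ->
    dotp (V i s) (V j s) = (i == j)%:R ;
  frenet_first : forall s, I s -> derive1 (V 1%N) s = k 1%N s *: V 2%N s ;
  frenet_middle : forall i s, (2 <= i <= n.-1)%N -> I s ->
    derive1 (V i) s = - k i.-1 s *: V i.-1 s + k i s *: V i.+1 s ;
  frenet_last : forall s, I s ->
    derive1 (V n) s = - k n.-1 s *: V n.-1 s
}.

(* derive1 alpha is the tangent V_1. The angle phi between two unit vectors lies
   in [0, pi]. *)
Definition inclined_curve (R : realType) (n : nat) (I : set R)
    (alpha : R -> 'rV[R]_n) : Prop :=
  exists (X : 'rV[R]_n) (phi : R),
    [/\ enorm X = 1, 0 <= phi <= pi, phi <> pi / 2 &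
        forall s, I s -> dotp (derive1 alpha s) X = cos phi].

Fixpoint harmonic_curvature (R : realType) (k : nat -> R -> R) (i : nat) :
    R -> R :=
  match i with
  | 0 => fun=> 0
  | i1.+1 =>
    match i1 with
    | 0 => fun s => k 1%N s / k 2%N s
    | i2.+1 => fun s =>
        (k i.+1 s)^-1 * (derive1 (harmonic_curvature k i1) s
                         + k i s * harmonic_curvature k i2 s)
    end
  end.

(* Main.v *)
Require Import Defs.
From HB Require Import structures.
From mathcomp Require Import all_boot all_order all_algebra.
From mathcomp Require Import all_classical all_reals all_analysis.
From mathcomp Require Import ring lra zify.
Import Order.TTheory GRing.Theory Num.Theory.
Import numFieldNormedType.Exports.
Local Open Scope classical_set_scope.
Local Open Scope ring_scope.

(** The axis X of an inclined curve has constant coordinates in space, so its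
    coordinates x_i = <V_i, X> in the Frenet frame satisfy the Frenet formulas
      x_i' = k_i x_(i+1) - k_(i-1) x_(i-1)   (1 <= i <= n, k_0 = k_n = 0),
    a linear system with a tridiagonal skew-symmetric matrix. Solving the first
    n - 1 equations one after the other from x_1 = 1 gives x_2 = 0 and
    x_(i+2) = H_i: the harmonic curvatures are by definition a solution of all but
    the last equation, and the curve is inclined exactly when the last equation,
    H_(n-2)' + k_(n-1) H_(n-3) = 0, holds as well. Write g for its left-hand side.

    If the curve is inclined, uniqueness of the recursion
    ([skew_system_proportional]) shows x_i = cos phi * (1, 0, H_1, ..., H_(n-2))_i,
    and skew symmetry ([skew_system_pairing]) makes the sum of squares constant.
    Going down the recursion, H_(n-2) = 0 on I would force x_1 = cos phi = 0.

    Conversely, skew symmetry turns the derivative of 1 + sum H_i^2 into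
    2 g H_(n-2), so that g H_(n-2) = 0 on I. The delicate point is that H_(n-2) may
    have zeros, even fill an interval with them, and g has to vanish there too.
    Near a boundary point of the set where H_(n-2) is nonzero, both H_(n-2) and g
    would vanish to infinite order; the recursion, read downwards, would then make
    every x_i vanish there, contradicting x_1 = 1. This is phrased algebraically: the
    differential ideal generated by H_(n-2) and g contains x_1 = 1
    ([skew_system_unit_ideal]), and two smooth functions on an interval that generate
    the unit differential ideal and have product 0 cannot both be nonzero
    ([smooth_product_eq0]). As H_(n-2) is not identically 0, g is, and the vector
    V_1 + sum H_i V_(i+2) is constant; normalized, it is the axis. *)

Set Implicit Arguments.
Unset Strict Implicit.

(** * Derivatives of scalar functions *)

Section Pointwise.
Context {R : realType}.
Implicit Types (f g : R -> R) (s : R).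

Lemma derive1_add f g s : derivable f s 1 -> derivable g s 1 ->
  derive1 (fun t => f t + g t) s = derive1 f s + derive1 g s :> R.
Proof. by move=> df dg; rewrite !derive1E; exact: (deriveD df dg). Qed.

Lemma derivable_add f g s : derivable f s 1 -> derivable g s 1 ->
  derivable (fun t => f t + g t) s 1.
Proof. by move=> df dg; exact: (derivableD df dg). Qed.

Lemma derivable_mul f g s : derivable f s 1 -> derivable g s 1 ->
  derivable (fun t => f t * g t) s 1.
Proof. by move=> df dg; exact: (derivableM df dg). Qed.

Lemma derive1_mul f g s : derivable f s 1 -> derivable g s 1 ->
  derive1 (fun t => f t * g t) s = derive1 f s * g s + f s * derive1 g s :> R.
Proof.
move=> df dg; rewrite !derive1E addrC ['D_1 f s * _]mulrC.
exact: (deriveM df dg).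
Qed.

Lemma derive1_inv f s : f s != 0 -> derivable f s 1 ->
  derive1 (fun t => (f t)^-1) s = - (derive1 f s * ((f s)^-1 * (f s)^-1)) :> R.
Proof.
move=> f0 df; rewrite !derive1E -invfM -expr2 mulrC -mulNr.
exact: (deriveV f0 df).
Qed.

Lemma derivable_bigsum (T : Type) (r : seq T) (P : pred T) (F : T -> R -> R) s :
  (forall i, P i -> derivable (F i) s 1) ->
  let S : R -> R := fun t => \sum_(i <- r | P i) F i t in
  derivable S s 1 /\ derive1 S s = \sum_(i <- r | P i) derive1 (F i) s :> R.
Proof.
move=> dF; elim: r => [|i r IHr] S.
  have -> : S = cst 0 by apply/funext => t; rewrite /S big_nil.
  by rewrite derive1_cst big_nil.
set U : R -> R := fun t => _ in IHr; case: IHr => d1 d2.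
rewrite big_cons; case: ifPn => [Pi|nPi]; last first.
  have -> // : S = U by apply/funext => t; rewrite /S big_cons (negbTE nPi).
have -> : S = (fun t => F i t + U t) :> (R -> R).
  by apply/funext => t; rewrite /S big_cons Pi.
split; first exact: (derivable_add (dF i Pi) d1).
by rewrite (derive1_add (dF i Pi) d1) d2.
Qed.

End Pointwise.

Lemma eq_on_near {R : realType} {V : Type} (I : set R) (f g : R -> V) s :
  open I -> {in I, f =1 g} -> I s -> \near s, f s = g s.
Proof.
move=> Iopen fg Is; near=> t; apply: fg; rewrite inE.
by near: t; exact: open_nbhs_nbhs.
Unshelve. all: by end_near. Qed.

Lemma eq_on_derivable {R : realType} {V : normedModType R} (I : set R)
    (f g : R -> V) s :
  open I -> {in I, f =1 g} -> I s -> derivable f s 1 -> derivable g s 1.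
Proof. move=> Iopen fg Is; apply: near_eq_derivable; exact: eq_on_near Iopen fg Is. Qed.

Lemma eq_on_derive1 {R : realType} {V : normedModType R} (I : set R)
    (f g : R -> V) :
  open I -> {in I, f =1 g} -> {in I, derive1 f =1 derive1 g}.
Proof.
move=> Iopen fg s; rewrite inE => Is; rewrite !derive1E.
by apply: near_eq_derive; exact: eq_on_near Iopen fg Is.
Qed.

Lemma derive1_coord {R : realType} {n : nat} (F : R -> 'rV[R]_n) j s :
  derivable F s 1 -> derive1 (fun t => F t 0 j) s = derive1 F s 0 j.
Proof. by move=> dF; rewrite !derive1E derive_mx// mxE. Qed.

Lemma smooth_on_derivable {R : realType} {V : normedModType R} (I : set R)
  (f : R -> V) s : smooth_on I f -> I s -> derivable f s 1.
Proof. by move=> sf; exact: (sf 0%N). Qed.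

Lemma smooth_on_derive1 {R : realType} {V : normedModType R} (I : set R)
  (f : R -> V) : smooth_on I f -> smooth_on I (derive1 f).
Proof. by move=> sf m s Is; have := sf m.+1 s Is; rewrite derive1Sn. Qed.

(** * Smooth scalar functions *)

(** The ring generated by the coordinates of smooth curves and by the constants,
    with inverses of nowhere vanishing functions. Presenting smoothness by
    generators makes every closure property a constructor; what has to be proved
    is stability under differentiation, by induction on the generation. *)
Inductive smooth_scalar {R : realType} (I : set R) : (R -> R) -> Prop :=
| smooth_scalar_coord (n : nat) (F : R -> 'rV[R]_n) j :
    smooth_on I F -> smooth_scalar I (fun s => F s 0 j)
| smooth_scalar_cst c : smooth_scalar I (fun=> c)
| smooth_scalar_add f g : smooth_scalar I f -> smooth_scalar I g ->
    smooth_scalar I (fun s => f s + g s)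
| smooth_scalar_mul f g : smooth_scalar I f -> smooth_scalar I g ->
    smooth_scalar I (fun s => f s * g s)
| smooth_scalar_inv f : smooth_scalar I f -> (forall s, I s -> f s != 0) ->
    smooth_scalar I (fun s => (f s)^-1)
| smooth_scalar_ext f g : {in I, f =1 g} -> smooth_scalar I f ->
    smooth_scalar I g.

Section SmoothScalar.
Context {R : realType} (I : set R).
Hypothesis Iopen : open I.
Implicit Types f g : R -> R.

Lemma smooth_scalar_opp f : smooth_scalar I f -> smooth_scalar I (fun s => - f s).
Proof.
move=> sf; apply: (@smooth_scalar_ext _ _ (fun s => -1 * f s)).
  by move=> s _; rewrite mulN1r.
by apply: smooth_scalar_mul => //; exact: smooth_scalar_cst.
Qed.

Lemma smooth_scalar_differentiation f : smooth_scalar I f ->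
  (forall s, I s -> derivable f s 1) /\ smooth_scalar I (derive1 f).
Proof.
elim=> {f}.
- move=> n F j sF; have dF s := smooth_on_derivable (s := s) sF.
  split; first by move=> s Is; move: (dF s Is) => /derivable_mxP; exact.
  apply: (@smooth_scalar_ext _ _ (fun s => derive1 F s 0 j)).
    by move=> s; rewrite inE => Is; rewrite derive1_coord//; exact: dF.
  exact/smooth_scalar_coord/smooth_on_derive1.
- move=> c; split=> [//|]; apply: (@smooth_scalar_ext _ _ (fun=> 0)).
    by move=> s _; rewrite derive1_cst.
  exact: smooth_scalar_cst.
- move=> f g _ [df sf] _ [dg sg]; split.
    by move=> s Is; apply: derivable_add; [exact: df|exact: dg].
  apply: (@smooth_scalar_ext _ _ (fun s => derive1 f s + derive1 g s)).
    by move=> s; rewrite inE => Is; rewrite derive1_add//; [exact: df|exact: dg].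
  exact: smooth_scalar_add.
- move=> f g sf0 [df sf] sg0 [dg sg]; split.
    by move=> s Is; apply: derivable_mul; [exact: df|exact: dg].
  apply: (@smooth_scalar_ext _ _ (fun s => derive1 f s * g s + f s * derive1 g s)).
    by move=> s; rewrite inE => Is; rewrite derive1_mul//; [exact: df|exact: dg].
  by apply: smooth_scalar_add; exact: smooth_scalar_mul.
- move=> f sf0 [df sf] f0; split.
    by move=> s Is; apply: derivableV; [exact: f0|exact: df].
  apply: (@smooth_scalar_ext _ _ (fun s => - (derive1 f s * ((f s)^-1 * (f s)^-1)))).
    by move=> s; rewrite inE => Is; rewrite derive1_inv//; [exact: f0|exact: df].
  apply: smooth_scalar_opp; apply: smooth_scalar_mul => //.
  by apply: smooth_scalar_mul; exact: smooth_scalar_inv.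
- move=> f g fg _ [df sf]; split.
    by move=> s Is; apply: (eq_on_derivable Iopen fg Is (df s Is)).
  by apply: smooth_scalar_ext sf; exact: eq_on_derive1.
Qed.

Lemma smooth_scalar_derivable f s : smooth_scalar I f -> I s -> derivable f s 1.
Proof. by move=> /smooth_scalar_differentiation[+ _]; exact. Qed.

Lemma smooth_scalar_derive1 f : smooth_scalar I f -> smooth_scalar I (derive1 f).
Proof. by case/smooth_scalar_differentiation. Qed.

Lemma smooth_scalar_continuous f s : smooth_scalar I f -> I s -> {for s, continuous f}.
Proof.
move=> sf Is; apply/differentiable_continuous/derivable1_diffP.
exact: smooth_scalar_derivable.
Qed.

Lemma smooth_scalar_near_neq0 f s : smooth_scalar I f -> I s -> f s != 0 ->
  \forall t \near s, I t /\ f t != 0.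
Proof.
move=> sf Is fs0; near=> t; split.
  by near: t; exact: open_nbhs_nbhs.
by near: t; exact: (cvgr_neq0 _ (smooth_scalar_continuous sf Is) fs0).
Unshelve. all: by end_near. Qed.

Lemma smooth_scalar_sum (T : Type) (r : seq T) (P : pred T) (F : T -> R -> R) :
  (forall i, P i -> smooth_scalar I (F i)) ->
  smooth_scalar I (fun s => \sum_(i <- r | P i) F i s).
Proof.
move=> sF; elim: r => [|i r IHr].
  apply: smooth_scalar_ext (smooth_scalar_cst I 0) => s _.
  by rewrite big_nil.
have [Pi|nPi] := boolP (P i); last first.
  by apply: smooth_scalar_ext IHr => s _; rewrite big_cons (negbTE nPi).
apply: smooth_scalar_ext (smooth_scalar_add (sF i Pi) IHr) => s _.
by rewrite big_cons Pi.
Qed.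

Hypothesis Iitv : is_interval I.

Lemma derive1_eq0_cst f : smooth_scalar I f -> (forall s, I s -> derive1 f s = 0) ->
  forall s t, I s -> I t -> f s = f t.
Proof.
move=> sf f'0.
suff le_cst s t : s <= t -> I s -> I t -> f s = f t.
  move=> s t Is It; case: (leP s t) => [|/ltW] st; first exact: le_cst.
  by rewrite (le_cst t s).
move=> st Is It.
have Iu u : u \in `[s, t] -> I u by rewrite in_itv/=; exact: Iitv.
have [||c] := @MVT_segment R f (fun=> 0) s t st.
- move=> u us; have {}us : I u by apply: Iu; apply: subset_itv_oo_cc.
  by apply: DeriveDef; [exact: smooth_scalar_derivable|rewrite -derive1E f'0].
- by apply: derivable_within_continuous => u /Iu Iu'; exact: smooth_scalar_derivable.
by move=> _ /eqP; rewrite mul0r subr_eq0 => /eqP.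
Qed.

(** A continuous function with values in {0, 1} is constant on an interval. For a
    smooth one this takes no intermediate value theorem: differentiating f * f = f
    gives (2 f - 1) f' = 0, and 2 f - 1 has no zero. *)
Lemma smooth_scalar_idempotent f : smooth_scalar I f ->
  (forall s, I s -> f s = 0 \/ f s = 1) ->
  (forall s, I s -> f s = 0) \/ (forall s, I s -> f s = 1).
Proof.
move=> sf f01.
have f'0 s : I s -> derive1 f s = 0.
  move=> Is; have fE : {in I, (fun t => f t * f t) =1 f}.
    by move=> t; rewrite inE => /f01[] ->; rewrite ?mulr0 ?mulr1.
  have := eq_on_derive1 Iopen fE (mem_set Is).
  rewrite derive1_mul; [|exact: smooth_scalar_derivable..].
  by case: (f01 s Is) => ->; lra.
have fc := derive1_eq0_cst sf f'0.
have [[s [Is fs]]|nf0] := pselect (exists s, I s /\ f s = 0).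
  by left=> t It; rewrite (fc t s).
by right=> t It; case: (f01 t It) => // ft; case: nf0; exists t.
Qed.

End SmoothScalar.

(** * Differential ideals and zero divisors *)

(** The smooth functions on an interval do have zero divisors, such as two bumps
    with disjoint supports. Differential ideals are used to rule them out for a
    pair (u, v) that generates the unit ideal. *)
Record diff_ideal {R : realType} (I : set R) (P : (R -> R) -> Prop) : Prop := {
  diff_ideal_ext : forall f g, {in I, f =1 g} -> P f -> P g ;
  diff_ideal_add : forall f g, P f -> P g -> P (fun s => f s + g s) ;
  diff_ideal_mul : forall f g, smooth_scalar I f -> P g ->
    P (fun s => f s * g s) ;
  diff_ideal_derive : forall f, P f -> P (derive1 f) }.

Section Ideals.
Context {R : realType} (I : set R).
Hypothesis Iopen : open I.
Implicit Types (f g u v : R -> R) (P : (R -> R) -> Prop).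

Lemma diff_ideal_sub P f g : diff_ideal I P -> P f -> P g ->
  P (fun s => f s - g s).
Proof.
move=> iP Pf Pg; apply: (diff_ideal_add iP) => //.
apply: (@diff_ideal_ext _ _ _ iP (fun s => -1 * g s)).
  by move=> s _; rewrite mulN1r.
by apply: (diff_ideal_mul iP) => //; exact: smooth_scalar_cst.
Qed.

Lemma diff_ideal_vanishing : diff_ideal I (fun f => {in I, f =1 (fun=> 0)}).
Proof.
split=> [f g fg f0 s Is|f g f0 g0 s Is|f g _ g0 s Is|f f0 s Is].
- by rewrite -fg// f0.
- by rewrite f0// g0// addr0.
- by rewrite g0// mulr0.
- by rewrite (eq_on_derive1 Iopen f0 Is) derive1_cst.
Qed.

(** Smoothness is asked of both summands, and not only of w, so that differentiating
    or multiplying w acts on each summand. *)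
Definition vanishing_sum (U W : set R) (w : R -> R) : Prop :=
  exists f h, [/\ smooth_scalar I f, smooth_scalar I h,
    {in I, w =1 (fun s => f s + h s)},
    {in U, f =1 (fun=> 0)} & {in W, h =1 (fun=> 0)}].

(** U and W have to be open for functions vanishing on them to have derivatives
    vanishing on them. *)
Lemma diff_ideal_vanishing_sum (U W : set R) : open U -> open W ->
  diff_ideal I (vanishing_sum U W).
Proof.
move=> oU oW; split.
- move=> w w' ww' [f [h [sf sh wE f0 h0]]]; exists f, h; split=> // s Is.
  by rewrite -ww'// wE.
- move=> w w' [f [h [sf sh wE f0 h0]]] [f' [h' [sf' sh' wE' f0' h0']]].
  exists (fun s => f s + f' s), (fun s => h s + h' s); split.
  + exact: smooth_scalar_add.
  + exact: smooth_scalar_add.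
  + by move=> s Is; rewrite wE// wE'// addrACA.
  + by move=> s Us; rewrite f0// f0'// addr0.
  + by move=> s Ws; rewrite h0// h0'// addr0.
- move=> a w sa [f [h [sf sh wE f0 h0]]].
  exists (fun s => a s * f s), (fun s => a s * h s); split.
  + exact: smooth_scalar_mul.
  + exact: smooth_scalar_mul.
  + by move=> s Is; rewrite wE// mulrDr.
  + by move=> s Us; rewrite f0// mulr0.
  + by move=> s Ws; rewrite h0// mulr0.
- move=> w [f [h [sf sh wE f0 h0]]]; exists (derive1 f), (derive1 h); split.
  + exact: smooth_scalar_derive1.
  + exact: smooth_scalar_derive1.
  + move=> s Is; rewrite (eq_on_derive1 Iopen wE Is).
    by move: Is; rewrite inE => Is; apply: derive1_add;
      apply: smooth_scalar_derivable Is.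
  + by move=> s Us; rewrite (eq_on_derive1 oU f0 Us) derive1_cst.
  + by move=> s Ws; rewrite (eq_on_derive1 oW h0 Ws) derive1_cst.
Qed.

Hypothesis Iitv : is_interval I.

(** Let U be the set where u is nonzero and W the interior of the zero set of u.
    Since u * v = 0, v vanishes on U, and u vanishes on W; so u and v both lie in
    the differential ideal of the sums f + h with f = 0 on U and h = 0 on W, and
    hence 1 = f + h for some such f and h. As U and W have a dense union, f takes
    only the values 0 and 1, so it is constant: f = 1 makes U empty, so u = 0;
    f = 0 makes W empty, so v, which lives on W only, vanishes. *)
Lemma smooth_product_eq0 u v : smooth_scalar I u -> smooth_scalar I v ->
  (forall s, I s -> u s * v s = 0) ->
  (forall P, diff_ideal I P -> P u -> P v -> P (fun=> 1)) ->
  (forall s, I s -> u s = 0) \/ (forall s, I s -> v s = 0).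
Proof.
move=> su sv uv0 unit_uv.
pose U : set R := [set s : R | \forall t \near s, I t /\ u t != 0].
pose W : set R := [set s : R | \forall t \near s, u t = 0].
have Uin s : I s -> u s != 0 -> s \in U.
  by move=> Is us; rewrite inE; exact: smooth_scalar_near_neq0.
have oU : open U by rewrite openE => s /nbhs_interior.
have oW : open W by rewrite openE => s /nbhs_interior.
have [||f [h [sf sh fh1 f0 h0]]] := unit_uv _ (diff_ideal_vanishing_sum oU oW).
- exists (fun=> 0), u; split=> //; first exact: smooth_scalar_cst.
    by move=> s _; rewrite add0r.
  by move=> s; rewrite inE => Ws; exact: (nbhs_singleton Ws).
- exists v, (fun=> 0); split=> //; first exact: smooth_scalar_cst.
    by move=> s _; rewrite addr0.
  move=> s; rewrite inE => /nbhs_singleton[Is us0].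
  by apply/eqP; have /eqP := uv0 s Is; rewrite mulf_eq0 (negbTE us0).
(* f s <> 0 persists near s, which keeps a neighbourhood of s out of U, so
   that s belongs to W, where h = 0. *)
have f01 s : I s -> f s = 0 \/ f s = 1.
  move=> Is; have [|fs0] := eqVneq (f s) 0; [by left|right].
  have sW : s \in W.
    rewrite inE; apply: filterS (smooth_scalar_near_neq0 Iopen sf Is fs0).
    move=> t [It ft0]; apply/eqP; apply: contraNT ft0 => ut0.
    by rewrite f0//; exact: Uin.
  by rewrite [RHS](fh1 s (mem_set Is)) h0// addr0.
have [fI0|fI1] := smooth_scalar_idempotent Iopen Iitv sf f01.
- right=> s Is; apply/eqP; apply: contraT => vs0.
  have sW : s \in W.
    rewrite inE; apply: filterS (smooth_scalar_near_neq0 Iopen sv Is vs0).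
    move=> t [It vt0]; apply/eqP; have /eqP := uv0 t It.
    by rewrite mulf_eq0 (negbTE vt0) orbF.
  have := fh1 s (mem_set Is).
  by rewrite h0// fI0// addr0 => /eqP; rewrite oner_eq0.
- left=> s Is; apply/eqP; apply: contraT => us0.
  by have /eqP := fI1 s Is; rewrite f0 ?Uin// eq_sym oner_eq0.
Qed.

End Ideals.

(** * Skew-symmetric tridiagonal systems *)

Section SkewSystems.
Context {R : realType}.

(** Row i of the tridiagonal skew-symmetric matrix with superdiagonal kap, applied
    to x. With kap 0 = kap n = 0 no out-of-range entry of x contributes to the
    rows 1, ..., n, so that the first and last Frenet formulas are not special. *)
Definition skew_step (kap x : nat -> R) (i : nat) : R :=
  kap i * x i.+1 - kap i.-1 * x i.-1.

Lemma skew_antisym (n : nat) (kap x y : nat -> R) :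
  kap 0%N = 0 -> kap n = 0 ->
  \sum_(1 <= i < n.+1) (skew_step kap x i * y i + x i * skew_step kap y i) = 0.
Proof.
move=> kap0 kapn.
pose T i := kap i * (x i.+1 * y i + x i * y i.+1).
rewrite (@telescope_sumr_eq _ 1 n.+1 (fun i => T i.-1))//=.
  by rewrite /T kap0 kapn !mul0r subrr.
case=> [//|i] _; rewrite /skew_step /T /=; ring.
Qed.

(** Only the last of the n equations may fail, by the defect g: this is the freedom
    that the harmonic curvatures of an arbitrary curve have. *)
Definition skew_system (I : set R) (n : nat) (kap x : nat -> R -> R)
    (g : R -> R) : Prop :=
  forall i s, (1 <= i <= n)%N -> I s ->
    derive1 (x i) s = skew_step (kap^~ s) (x^~ s) i + (i == n)%:R * g s.

Variables (I : set R) (n : nat) (kap : nat -> R -> R).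
Hypothesis Iopen : open I.
Hypothesis n_gt0 : (0 < n)%N.
Hypothesis kap0 : forall s, kap 0%N s = 0.
Hypothesis kapn : forall s, kap n s = 0.
Implicit Types (x y : nat -> R -> R) (g h : R -> R).

(** The skew part cancels, so the scalar product of two solutions can vary only
    through the defects. *)
Lemma skew_system_pairing x y g h s :
  (forall i, (1 <= i <= n)%N -> smooth_scalar I (x i)) ->
  (forall i, (1 <= i <= n)%N -> smooth_scalar I (y i)) ->
  skew_system I n kap x g -> skew_system I n kap y h -> I s ->
  derive1 (fun t => \sum_(1 <= i < n.+1) x i t * y i t) s =
    g s * y n s + x n s * h s.
Proof.
move=> sx sy xE yE Is.
rewrite (_ : (fun t => _) = fun t =>
    \sum_(1 <= i < n.+1 | (1 <= i < n.+1)%N) x i t * y i t); last first.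
  by apply/funext => t; rewrite big_nat.
have [|_ ->] := @derivable_bigsum R _ (index_iota 1 n.+1)
    (fun i => (1 <= i < n.+1)%N) (fun i t => x i t * y i t) s.
  move=> i i1n; apply: derivable_mul.
    by apply: (smooth_scalar_derivable Iopen) Is; exact: sx.
  by apply: (smooth_scalar_derivable Iopen) Is; exact: sy.
rewrite -big_nat.
rewrite (@eq_big_nat _ _ _ _ _ _ (fun i =>
    (skew_step (kap^~ s) (x^~ s) i * y i s + x i s * skew_step (kap^~ s) (y^~ s) i) +
    (i == n)%:R * (g s * y i s + x i s * h s))); last first.
  move=> i i1n; rewrite derive1_mul.
  - by rewrite xE// yE//; ring.
  - by apply: (smooth_scalar_derivable Iopen) Is; exact: sx.
  - by apply: (smooth_scalar_derivable Iopen) Is; exact: sy.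
rewrite big_split/= skew_antisym// add0r big_nat_recr//= eqxx mul1r.
rewrite big_nat big1 ?add0r// => i /andP[_ lin].
by rewrite (ltn_eqF lin) mul0r.
Qed.

Hypothesis kap_smooth : forall i, (1 <= i < n)%N -> smooth_scalar I (kap i).
Hypothesis kap_neq0 : forall i s, (1 <= i < n)%N -> I s -> kap i s != 0.

(** Equation i can be solved for the unknown of index i + 1 because kap i does not
    vanish: the first component of a solution determines all of them. The recursion
    stops before the last equation, which is why x may have any defect. *)
Lemma skew_system_proportional x y g (c : R) :
  (forall i s, (1 <= i <= n)%N -> I s -> derivable (x i) s 1) ->
  skew_system I n kap x g -> skew_system I n kap y (fun=> 0) ->
  (forall s, I s -> y 1%N s = c * x 1%N s) ->
  forall i s, (1 <= i <= n)%N -> I s -> y i s = c * x i s.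
Proof.
move=> dx xE yE y1.
suff prop i : (i < n)%N -> forall s, I s -> y i.+1 s = c * x i.+1 s /\
    kap i s * y i s = c * (kap i s * x i s).
  by case=> [//|i] s /prop h Is; have [] := h s Is.
elim: i => [|i IHi] lin s Is; first by rewrite y1// kap0 !mul0r mulr0.
have {}IHi := IHi (ltnW lin).
(* The derivative at s depends on the values near s, hence an identity on I. *)
have yxi : {in I, y i.+1 =1 (fun t => c * x i.+1 t)}.
  by move=> t; rewrite inE => /IHi[].
have [yi kyi] := IHi s Is.
split; last by rewrite yi; ring.
have k0 : kap i.+1 s != 0 by exact: kap_neq0.
have dxi : derivable (x i.+1) s 1 by apply: dx => //=; exact: ltnW.
apply: (mulfI k0).
have := eq_on_derive1 Iopen yxi (mem_set Is).
rewrite (derive1_mul (derivable_cst _ _ _) dxi) derive1_cst mul0r add0r.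
rewrite xE ?yE//=; [|exact: ltnW..].
by rewrite (ltn_eqF lin) /skew_step/= !mul0r kyi => h; lra.
Qed.

(** The same recursion read downwards: equation i expresses the unknown of index
    i - 1 through those of indices i and i + 1 and a derivative, the first step
    using the defect. For a solution whose first component is 1, the last component
    and the defect therefore generate the unit differential ideal. *)
Lemma skew_system_unit_ideal x g (P : (R -> R) -> Prop) :
  skew_system I n kap x g -> diff_ideal I P -> P (x n) -> P g -> P (x 1%N).
Proof.
move=> xE iP Pxn Pg.
suff descent m : (m < n)%N -> P (x (n - m)%N) /\
    P (fun s => kap (n - m)%N s * x (n - m)%N.+1 s).
  have [] := descent n.-1; first by rewrite prednK.
  by rewrite (_ : (n - n.-1)%N = 1%N)//; lia.
elim: m => [|m IHm] mn.
  rewrite subn0; split=> //.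
  apply: (diff_ideal_ext iP _ (diff_ideal_mul iP (smooth_scalar_cst I 0) Pg)).
  by move=> s _; rewrite kapn !mul0r.
have [Px Pkx] := IHm (ltnW mn).
move: Px Pkx; rewrite (_ : (n - m)%N = (n - m.+1)%N.+1); last by lia.
set i := (n - m.+1)%N => Px Pkx.
have i1n : (1 <= i < n)%N by rewrite /i; lia.
split; last first.
  by apply: (diff_ideal_mul iP) => //; exact: kap_smooth.
have Pkxi : P (fun s => kap i s * x i s).
  have PR := diff_ideal_sub iP (diff_ideal_add iP Pkx
    (diff_ideal_mul iP (smooth_scalar_cst I (i.+1 == n)%:R) Pg))
    (diff_ideal_derive iP Px).
  apply: (diff_ideal_ext iP _ PR) => s; rewrite inE => Is.
  by rewrite xE//; [rewrite /skew_step/=; ring|case/andP: i1n].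
have ski := smooth_scalar_inv (kap_smooth i1n) (fun s => @kap_neq0 i s i1n).
apply: (diff_ideal_ext iP _ (diff_ideal_mul iP ski Pkxi)).
by move=> s; rewrite inE => Is; rewrite mulKf// kap_neq0.
Qed.

End SkewSystems.

(** * Harmonic curvatures as a solution of the Frenet system *)

Section Frenet.
Context {R : realType}.

Definition frenet_coef (n : nat) (k : nat -> R -> R) (i : nat) (s : R) : R :=
  if (1 <= i < n)%N then k i s else 0.

(** The coordinates, up to the factor cos phi, of the axis of a helix in the Frenet
    frame: 1 along V_1, 0 along V_2 and H_i along V_(i+2). Since H_0 = 0, the shift
    by two of the harmonic curvatures gives the coordinate along V_2 as well. *)
Definition harmonic_coord (k : nat -> R -> R) (i : nat) : R -> R :=
  match i with
  | 0 => fun=> 0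
  | 1 => fun=> 1
  | i'.+2 => harmonic_curvature k i'
  end.

(** On the curvatures of a curve this is H_(n-2)' + k_(n-1) H_(n-3), whose vanishing
    is the equation that the recursive definition of the H_i leaves out. *)
Definition harmonic_defect (n : nat) (k : nat -> R -> R) (s : R) : R :=
  derive1 (harmonic_coord k n) s
  - skew_step (frenet_coef n k ^~ s) (harmonic_coord k ^~ s) n.

Variables (I : set R) (n : nat) (k : nat -> R -> R).
Hypothesis Iopen : open I.
Hypothesis n_ge2 : (1 < n)%N.
Hypothesis k_neq0 : forall i s, (1 <= i < n)%N -> I s -> k i s != 0.

Lemma harmonic_skew_system :
  skew_system I n (frenet_coef n k) (harmonic_coord k) (harmonic_defect n k).
Proof.
move=> i s i1n Is; have [->|ni] := eqVneq i n.
  by rewrite /harmonic_defect mul1r addrC subrK.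
have lin : (1 <= i < n)%N by lia.
rewrite mul0r addr0 /skew_step /frenet_coef lin.
case: i lin {i1n ni} => [|[|[|i]]]//= lin.
- by rewrite derive1_cst; ring.
- rewrite derive1_cst (ltnW lin) mulrC divfK; first by rewrite mulr1 subrr.
  exact: k_neq0.
- rewrite (ltnW lin) mulVKf; last exact: k_neq0.
  by rewrite addrK.
Qed.

Hypothesis k_smooth : forall i, (1 <= i < n)%N -> smooth_scalar I (k i).

Lemma smooth_harmonic_coord i : (i <= n)%N -> smooth_scalar I (harmonic_coord k i).
Proof.
have sk j : (j < n)%N -> (0 < j)%N -> smooth_scalar I (k j).
  by move=> jn j0; apply: k_smooth; rewrite j0.
have skV j : (j < n)%N -> (0 < j)%N -> smooth_scalar I (fun s => (k j s)^-1).
  move=> jn j0; apply: smooth_scalar_inv; first exact: sk.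
  by move=> s; apply: k_neq0; rewrite j0.
suff /(_ i) [] : forall i, ((i <= n)%N -> smooth_scalar I (harmonic_coord k i)) /\
    ((i.+1 <= n)%N -> smooth_scalar I (harmonic_coord k i.+1)) by [].
elim=> [|{}i [IHi IHi1]]; first by split=> _; exact: smooth_scalar_cst.
split=> // lin; case: i IHi IHi1 lin => [|[|i]] IHi IHi1 lin /=.
- exact: smooth_scalar_cst.
- by apply: smooth_scalar_mul; [exact: sk|exact: skV].
- apply: smooth_scalar_mul; first exact: skV.
  apply: smooth_scalar_add.
    by apply: (smooth_scalar_derive1 Iopen); apply: IHi1; exact: ltnW.
  by apply: smooth_scalar_mul; [apply: sk => //; exact: ltnW|apply: IHi; lia].
Qed.

Lemma smooth_harmonic_defect : smooth_scalar I (harmonic_defect n k).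
Proof.
have sn := smooth_harmonic_coord (leqnn n).
have n1 : (1 <= n.-1 < n)%N by lia.
have sn1 := smooth_harmonic_coord (leq_pred n).
apply: (@smooth_scalar_ext _ _ (fun s =>
  derive1 (harmonic_coord k n) s + k n.-1 s * harmonic_coord k n.-1 s)).
  move=> s _; rewrite /harmonic_defect /skew_step /frenet_coef ltnn andbF n1.
  by rewrite mul0r sub0r opprK.
apply: smooth_scalar_add; first exact: smooth_scalar_derive1.
by apply: smooth_scalar_mul => //; exact: k_smooth.
Qed.

Lemma sum_sqr_harmonic_coord s :
  \sum_(1 <= i < n.+1) harmonic_coord k i s * harmonic_coord k i s =
  1 + \sum_(1 <= i < n.-1) harmonic_curvature k i s ^+ 2.
Proof.
rewrite big_ltn; last by lia.
rewrite big_ltn; last by lia.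
rewrite /= mulr0 add0r mulr1; congr (_ + _).
rewrite (_ : n.+1 = n.-1 + 2)%N; last by lia.
rewrite (big_addn 1 _ 2) addnK.
by apply: eq_bigr => i _; rewrite addn2 expr2.
Qed.

End Frenet.

(** * Scalar products of curves with a vector *)

Section Dotp.
Context {R : realType} {n : nat}.
Implicit Types (u v w : 'rV[R]_n) (a : R) (F G : R -> 'rV[R]_n) (I : set R).

Lemma dotpC u v : dotp u v = dotp v u.
Proof. by apply: eq_bigr => i _; rewrite mulrC. Qed.

Lemma dotpDl u v w : dotp (u + v) w = dotp u w + dotp v w.
Proof. by rewrite /dotp -big_split; apply: eq_bigr => i _; rewrite mxE mulrDl. Qed.

Lemma dotpZl a u v : dotp (a *: u) v = a * dotp u v.
Proof. by rewrite /dotp mulr_sumr; apply: eq_bigr => i _; rewrite mxE mulrA. Qed.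

Lemma dotp_suml (r : seq nat) (c : nat -> R) (W : nat -> 'rV[R]_n) v :
  dotp (\sum_(i <- r) c i *: W i) v = \sum_(i <- r) c i * dotp (W i) v.
Proof.
elim: r => [|i r IHr]; last by rewrite !big_cons dotpDl dotpZl IHr.
by rewrite !big_nil -(scale0r 0) dotpZl mul0r.
Qed.

Lemma smooth_dotp I F G : smooth_on I F -> smooth_on I G ->
  smooth_scalar I (fun s => dotp (F s) (G s)).
Proof.
move=> sF sG; apply: smooth_scalar_sum => i _.
by apply: smooth_scalar_mul; exact: smooth_scalar_coord.
Qed.

Lemma smooth_dotpl I F v : smooth_on I F ->
  smooth_scalar I (fun s => dotp (F s) v).
Proof.
move=> sF; apply: smooth_scalar_sum => i _.
by apply: smooth_scalar_mul; [exact: smooth_scalar_coord|exact: smooth_scalar_cst].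
Qed.

Lemma derive1_dotpl F v s : derivable F s 1 ->
  derive1 (fun t => dotp (F t) v) s = dotp (derive1 F s) v.
Proof.
move=> dF; have dFi (i : 'I_n) : derivable (fun t => F t 0 i) s 1.
  by move: dF => /derivable_mxP; exact.
have [|_ ->] := @derivable_bigsum R _ (index_enum 'I_n) xpredT
    (fun i t => F t 0 i * v 0 i) s.
  by move=> i _; apply: derivable_mul => //; exact: derivable_cst.
apply: eq_bigr => i _.
rewrite (derive1_mul (dFi i) (derivable_cst (v 0 i) s 1)).
by rewrite derive1_cst mulr0 addr0 derive1_coord.
Qed.

End Dotp.

(** * Inclined curves and harmonic curvatures *)

Section FrenetFrame.
Context {R : realType}.
Variables (n : nat) (I : set R) (alpha : R -> 'rV[R]_n).
Variables (V : nat -> R -> 'rV[R]_n) (k : nat -> R -> R).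
Hypothesis n_ge3 : (2 < n)%N.
Hypothesis Iopen : open I.
Hypothesis frenet : frenet_frame I alpha V k.

Lemma frenet_skew_system (e : 'rV[R]_n) :
  skew_system I n (frenet_coef n k) (fun i s => dotp (V i s) e) (fun=> 0).
Proof.
move=> i s i1n Is; rewrite mulr0 addr0 /skew_step /frenet_coef.
rewrite derive1_dotpl; last exact: smooth_on_derivable (frenet_smooth frenet i1n) Is.
have [i1|i1] := eqVneq i 1%N.
  rewrite i1 (frenet_first frenet Is) dotpZl ifT ?ifF//; last by lia.
  by rewrite mul0r subr0.
have [iN|iN] := eqVneq i n.
  rewrite iN (frenet_last frenet Is) dotpZl ifF ?ifT; [|lia..].
  by rewrite mul0r sub0r mulNr.
have i2n : (2 <= i <= n.-1)%N by lia.
rewrite (frenet_middle frenet i2n Is) dotpDl !dotpZl !ifT; [|lia..].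
by rewrite mulNr addrC.
Qed.

(** The Frenet formulas give k_i as the scalar product of V_i' and V_(i+1), so it
    inherits the smoothness of the frame. *)
Lemma curvature_smooth i : (1 <= i < n)%N -> smooth_scalar I (k i).
Proof.
move=> i1n.
apply: (@smooth_scalar_ext _ _ (fun s => dotp (derive1 (V i) s) (V i.+1 s))).
  move=> s; rewrite inE => Is.
  rewrite -derive1_dotpl; last first.
    by apply: smooth_on_derivable Is; apply: (frenet_smooth frenet); lia.
  have orth j : (1 <= j <= n)%N -> dotp (V j s) (V i.+1 s) = (j == i.+1)%:R.
    by move=> j1n; apply: (frenet_orthonormal frenet) => //; lia.
  rewrite (frenet_skew_system (V i.+1 s))//; last by lia.
  rewrite /skew_step /frenet_coef i1n mulr0 addr0 orth; last by lia.
  rewrite eqxx mulr1; case: ifP => [i1|_]; last by rewrite mul0r subr0.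
  rewrite orth; last by lia.
  by rewrite (_ : (i.-1 == i.+1) = false) ?mulr0 ?subr0//; lia.
apply: smooth_dotp; last by apply: (frenet_smooth frenet); lia.
by apply/smooth_on_derive1/(frenet_smooth frenet); lia.
Qed.

Hypothesis Iitv : is_interval I.
Hypothesis k_neq0 : forall i s, (1 <= i < n)%N -> I s -> k i s != 0.

Let n_gt0 : (0 < n)%N. Proof. exact: leq_trans n_ge3. Qed.
Let n_gt1 : (1 < n)%N. Proof. exact: leq_trans n_ge3. Qed.

Let kap0 s : frenet_coef n k 0 s = 0. Proof. by []. Qed.

Let kapn s : frenet_coef n k n s = 0.
Proof. by rewrite /frenet_coef ltnn andbF. Qed.

Let kap_neq0 i s : (1 <= i < n)%N -> I s -> frenet_coef n k i s != 0.
Proof. by move=> i1n Is; rewrite /frenet_coef i1n k_neq0. Qed.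

Let kap_smooth i : (1 <= i < n)%N -> smooth_scalar I (frenet_coef n k i).
Proof.
by move=> i1n; apply: smooth_scalar_ext (curvature_smooth i1n) => s _;
  rewrite /frenet_coef i1n.
Qed.

Let harmonicE := harmonic_skew_system n_gt1 k_neq0.

Let smooth_harmonic i (i1n : (1 <= i <= n)%N) : smooth_scalar I (harmonic_coord k i).
Proof.
case/andP: i1n => _.
exact: (smooth_harmonic_coord Iopen n_gt1 k_neq0 curvature_smooth).
Qed.

Lemma skew_pairing_cst (x y : nat -> R -> R) :
  (forall i, (1 <= i <= n)%N -> smooth_scalar I (x i)) ->
  (forall i, (1 <= i <= n)%N -> smooth_scalar I (y i)) ->
  skew_system I n (frenet_coef n k) x (fun=> 0) ->
  skew_system I n (frenet_coef n k) y (fun=> 0) ->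
  forall s t, I s -> I t ->
  \sum_(1 <= i < n.+1) x i s * y i s = \sum_(1 <= i < n.+1) x i t * y i t.
Proof.
move=> sx sy xE yE s t Is It.
pose F u := \sum_(1 <= i < n.+1) x i u * y i u.
apply: (@derive1_eq0_cst R I Iopen Iitv F _ _ s t Is It) => [|u Iu].
  rewrite (_ : F = fun u =>
    \sum_(1 <= i < n.+1 | (1 <= i < n.+1)%N) x i u * y i u); last first.
    by apply/funext => u; rewrite /F big_nat.
  by apply: smooth_scalar_sum => i i1n; apply: smooth_scalar_mul; [exact: sx|exact: sy].
rewrite /F (skew_system_pairing Iopen n_gt0 kap0 kapn sx sy xE yE Iu).
by rewrite mul0r mulr0 addr0.
Qed.

(** The coordinates of the axis X in the frame solve the Frenet system and start with
    cos phi, so they are cos phi times those given by the harmonic curvatures; their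
    sum of squares is constant because the system is skew. If the last one vanished
    identically, so would all the others, including cos phi. *)
Lemma inclined_harmonic s0 : I s0 ->
  inclined_curve I alpha ->
  (exists c : R, forall s, I s ->
     \sum_(1 <= i < n.-1) (harmonic_curvature k i s) ^+ 2 = c) /\
  ~ (forall s, I s -> harmonic_coord k n s = 0).
Proof.
move=> Is0 [X [phi [_ phi_range phi_neq alphaX]]].
have c0 : cos phi != 0.
  apply/eqP; rewrite -(@cos_pihalf R) => /cos_inj phiE; apply: phi_neq.
  apply: phiE; rewrite in_itv/= ?phi_range// divr_ge0 ?pi_ge0//=.
  by have := pi_ge0 R; lra.
pose y i s := dotp (V i s) X.
have sy i : (1 <= i <= n)%N -> smooth_scalar I (y i).
  by move=> i1n; apply: smooth_dotpl; exact: (frenet_smooth frenet).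
have yE : skew_system I n (frenet_coef n k) y (fun=> 0) := frenet_skew_system X.
have y1 s : I s -> y 1%N s = cos phi.
  by move=> Is; rewrite /y (frenet_tangent frenet Is) alphaX.
have yx : forall i s, (1 <= i <= n)%N -> I s -> y i s = cos phi * harmonic_coord k i s.
  apply: (skew_system_proportional Iopen kap0 kap_neq0 _ harmonicE yE) => [i s i1n Is|s Is].
    by apply: (smooth_scalar_derivable Iopen) Is; exact: smooth_harmonic.
  by rewrite /= mulr1; exact: y1.
split.
  exists (\sum_(1 <= i < n.+1) y i s0 * y i s0 / cos phi ^+ 2 - 1) => s Is.
  have -> : \sum_(1 <= i < n.+1) y i s0 * y i s0 / cos phi ^+ 2 =
      \sum_(1 <= i < n.+1) harmonic_coord k i s * harmonic_coord k i s.
    rewrite -mulr_suml (skew_pairing_cst sy sy yE yE Is0 Is) mulr_suml.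
    by apply: eq_big_nat => i i1n; rewrite yx//; field.
  by rewrite sum_sqr_harmonic_coord// addrC addKr.
move=> xn0.
have y_n0 : {in I, y n =1 (fun=> 0)}.
  by move=> s; rewrite inE => Is; rewrite yx ?n_gt0 ?leqnn// xn0// mulr0.
have y10 := skew_system_unit_ideal n_gt0 kapn kap_smooth kap_neq0 yE
  (diff_ideal_vanishing Iopen) y_n0 (fun _ _ => erefl).
by move: c0; rewrite -(y1 s0 Is0) y10 ?inE// eqxx.
Qed.

(** Differentiating the constant sum gives that the product of H_(n-2) and the defect
    is 0; these two functions generate the unit differential ideal, so the defect
    vanishes on all of I, also where H_(n-2) has zeros. The harmonic curvatures
    then solve the Frenet system exactly, and the vector Y with these coordinates
    is constant along the curve, with scalar product 1 with V_1. *)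
Lemma harmonic_inclined s0 c : I s0 ->
  (forall s, I s ->
     \sum_(1 <= i < n.-1) (harmonic_curvature k i s) ^+ 2 = c) ->
  ~ (forall s, I s -> harmonic_coord k n s = 0) ->
  inclined_curve I alpha.
Proof.
move=> Is0 Hc Hn.
pose x := harmonic_coord k; pose g := harmonic_defect n k.
have sg : smooth_scalar I g by exact: smooth_harmonic_defect curvature_smooth.
have sx := smooth_harmonic.
have nn : (1 <= n <= n)%N by rewrite n_gt0 leqnn.
have xg0 s : I s -> x n s * g s = 0.
  move=> Is; have := skew_system_pairing Iopen n_gt0 kap0 kapn sx sx harmonicE harmonicE Is.
  have sumE : {in I, (fun t => \sum_(1 <= i < n.+1)
      harmonic_coord k i t * harmonic_coord k i t) =1 (fun=> 1 + c)}.
    by move=> t; rewrite inE => It; rewrite sum_sqr_harmonic_coord// Hc.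
  rewrite (eq_on_derive1 Iopen sumE (mem_set Is)) derive1_cst.
  by rewrite -/x -/g => h; lra.
have unit_xg P : diff_ideal I P -> P (x n) -> P g -> P (fun=> 1).
  exact: (skew_system_unit_ideal n_gt0 kapn kap_smooth kap_neq0 harmonicE).
have [//|g0] := smooth_product_eq0 Iopen Iitv (sx n nn) sg xg0 unit_xg.
have xE : skew_system I n (frenet_coef n k) x (fun=> 0).
  by move=> i s i1n Is; rewrite harmonicE// -/g g0.
pose Y := \sum_(1 <= i < n.+1) x i s0 *: V i s0.
(* Y is defined with the frame at s0; that the same coordinates represent it at
   every s is tested against a fixed vector e. *)
have YE e s : I s -> dotp Y e = \sum_(1 <= i < n.+1) x i s * dotp (V i s) e.
  move=> Is; rewrite dotp_suml.
  apply: (skew_pairing_cst sx _ xE (frenet_skew_system e)) => // i i1n.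
  by apply: smooth_dotpl; exact: (frenet_smooth frenet).
have YV i s : (1 <= i <= n)%N -> I s -> dotp (V i s) Y = x i s.
  move=> i1n Is; rewrite dotpC (YE _ s Is).
  rewrite (bigD1_seq i) ?mem_index_iota ?iota_uniq//=.
  rewrite (frenet_orthonormal frenet)// eqxx mulr1 big_nat_cond big1 ?addr0//.
  move=> j /andP[j1n /negbTE ji].
  by rewrite (frenet_orthonormal frenet)// ji mulr0.
(* The first coordinate alone contributes 1. *)
have YY : 1 <= dotp Y Y.
  rewrite (YE _ s0 Is0) (@eq_big_nat _ _ _ _ _ _ (fun i => x i s0 * x i s0)).
    rewrite sum_sqr_harmonic_coord// lerDl.
    by apply: sumr_ge0 => i _; exact: sqr_ge0.
  by move=> i i1n; rewrite YV.
have N1 : 1 <= enorm Y by rewrite /enorm -(sqrtr1 R) ler_wsqrtr.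
have N0 : 0 < enorm Y by exact: lt_le_trans N1.
have NVle : (enorm Y)^-1 <= 1 by rewrite invf_le1.
have NV0 : 0 < (enorm Y)^-1 by rewrite invr_gt0.
have NVin : -1 <= (enorm Y)^-1 <= 1 by apply/andP; split; [lra|].
exists ((enorm Y)^-1 *: Y), (acos (enorm Y)^-1); split.
- have YN : dotp Y Y = enorm Y ^+ 2 by rewrite sqr_sqrtr// (le_trans ler01).
  rewrite /enorm dotpZl dotpC dotpZl -/(enorm Y) YN expr2 mulKf ?gt_eqF//.
  by rewrite mulVf ?gt_eqF// sqrtr1.
- by rewrite acos_ge0// acos_lepi.
- move=> /(congr1 cos); rewrite acosK ?in_itv//= cos_pihalf => h.
  by move: NV0; rewrite h ltxx.
- move=> s Is; rewrite acosK ?in_itv//= -(frenet_tangent frenet Is).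
  by rewrite dotpC dotpZl dotpC YV// mulr1.
Qed.

End FrenetFrame.

Unset Implicit Arguments.
Set Strict Implicit.

Theorem theorem3p2 (R : realType) (n : nat) (hn : (3 <= n)%N)
    (I : set R) (hI : open_interval I)
    (alpha : R -> 'rV[R]_n)
    (alpha_smooth : smooth_on I alpha)
    (alpha_unit : unit_speed I alpha)
    (V : nat -> R -> 'rV[R]_n) (k : nat -> R -> R)
    (frenet : frenet_frame I alpha V k)
    (k_neq0 : forall i s, (1 <= i <= n.-1)%N -> I s -> k i s <> 0) :
  inclined_curve I alpha <->
  (exists c : R, forall s, I s ->
     \sum_(1 <= i < n.-1) (harmonic_curvature k i s) ^+ 2 = c) /\
  ~ (forall s, I s -> harmonic_curvature k (n - 2) s = 0).
Proof.
case: hI => -[s0 Is0] Iopen Iitv.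
have k0 i s : (1 <= i < n)%N -> I s -> k i s != 0.
  by move=> i1n Is; apply/eqP; apply: k_neq0 => //; lia.
have -> : harmonic_curvature k (n - 2) = harmonic_coord k n.
  by rewrite -[in RHS](subnK (ltnW hn)) addn2.
split=> [|[[c Hc]]]; last first.
  exact: (harmonic_inclined hn Iopen frenet Iitv k0 Is0 Hc).
exact: (inclined_harmonic hn Iopen frenet Iitv k0 Is0).
Qed.
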